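(* There is a universal constant $c_{\rm cov}>0$ such that the following holds. Let $T=2K\ge4$ be an even integer, $r\in(0,1]$, and $0<\epsilon\le T/512$. There is a family of lost-sales inventory instances, together with prescribed sales-log boundaries, such that: (i) all instances share the common decision-coverage cap $7/8$, satisfying $F_t^-(7/8)>1/2$ in every period $t\in\{1,\ldots,T\}$, and retain positive above-cap demand mass, $\mathbb P(D_{t}>7/8)>0$, in the even periods $t$; (ii) every even-period boundary is $7/8$; in each odd period $2i-1$ ($i=1,\ldots,K$), exactly $rN_{2i-1}$ of the $N_{2i-1}$ predetermined logged observations have boundary $7/8$, while all remaining boundaries lie below $1/4$ (it is assumed for simplicity that the products $rN_{2i-1}$ are integers); (iii) even when $h_t=p_t=1$ for all $t$, any algorithm that, from these logs, returns an $\epsilon$-optimal lost-sales policy from $x_1=0$ (i.e. a feasible policy $\widehat\pi$ with $V_1^{\widehat\pi}(0)-V_1^*(0)\le\epsilon$) with probability at least $3/4$ on every instance of the family must use $$M\ge c_{\rm cov}\frac{T^3}{r\epsilon^2}$$ total logged observations, where $M=\sum_{t=1}^T N_t$.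
   Context: Lost-sales inventory model. Horizon $T$; write $u^+=\max\{u,0\}$. Demands $D_1,\ldots,D_T$ are independent with laws $P_t$ supported on a bounded interval $[0,\bar D]$. Holding and shortage coefficients $h_t,p_t>0$ are known. Fixed and per-unit ordering costs, lead time, and terminal salvage value are zero. Starting period $t$ with inventory $x_t\ge0$, the retailer chooses a post-order level $y_t\ge x_t$ before demand, and incurs cost $c_t(y_t,D_t)$ with $c_t(y,d)=h_t(y-d)^++p_t(d-y)^+$. The next state is $x_{t+1}=(y_t-D_t)^+$; only sales $\min\{D_t,y_t\}$ are observed. A feasible policy chooses each action using the information then available; randomization is allowed. $V_t^\pi(x)$ is the expected total cost of $\pi$ from period $t$ and state $x$, and $V_t^*(x)=\inf_\pi V_t^\pi(x)$. Notation: $F_t^-(u)=\mathbb P(D_t<u)$. Raw sales logs. For prescribed counts $N_t$, the data are the period-labeled array $((Z_t^j,b_t^j):t\in\{1,\ldots,T\},\,j\in\{1,\ldots,N_t\})$, where the boundary $b_t^j\ge0$ is known and $Z_t^j=\min\{D_t^j,b_t^j\}$ is observed, while the latent demand $D_t^j$ need not be observed. Here the boundaries are predetermined, and the latent demands $D_t^j$ are mutually independent with $D_t^j\sim P_t$. Every log counts toward the sample count $M=\sum_tN_t$. The algorithm knows the costs and the observation protocol but not the demand laws; it may be randomized, and the success probability is over the data and the algorithm's randomization. The returned policy is deployed on a fresh demand trajectory independent of the data. *)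

(* Defs.v *)
From HB Require Import structures.
From mathcomp Require Import all_boot all_order all_algebra.
From mathcomp Require Import all_classical all_reals all_analysis.

Set Implicit Arguments.
Unset Strict Implicit.
Unset Printing Implicit Defensive.

Import Order.TTheory GRing.Theory Num.Theory.
Import numFieldNormedType.Exports.

Local Open Scope classical_set_scope.
Local Open Scope ring_scope.

Section product_law.
Context {d : measure_display} {T : measurableType d} {R : realType}.

Definition tuple_cons (n : nat) (p : T * n.-tuple T) : n.+1.-tuple T :=
  [tuple of p.1 :: p.2].

Lemma measurable_tuple_cons (n : nat) :
  measurable_fun [set: T * n.-tuple T] (@tuple_cons n).
Proof. exact: measurable_cons measurable_fst measurable_snd. Qed.

Section step.
Context (n : nat) (P : probability T R) (Q : probability (n.-tuple T) R).

Definition cons_law : set (n.+1.-tuple T) -> \bar R :=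
  pushforward (P \x Q)%E (@tuple_cons n).

Let cons_law0 : cons_law set0 = 0%E.
Proof. by rewrite /cons_law /pushforward preimage_set0 measure0. Qed.

Let cons_law_ge0 A : (0 <= cons_law A)%E.
Proof. by rewrite /cons_law /pushforward measure_ge0. Qed.

Let cons_law_sigma_additive : semi_sigma_additive cons_law.
Proof.
move=> F mF tF mUF; rewrite /cons_law /pushforward preimage_bigcup.
apply: measure_semi_sigma_additive.
- by move=> k; rewrite -[X in measurable X]setTI; exact: measurable_tuple_cons.
- apply/trivIsetP => /= i j _ _ ij; rewrite -preimage_setI.
  by move/trivIsetP : tF => /(_ _ _ _ _ ij) ->//; rewrite preimage_set0.
- rewrite -preimage_bigcup -[X in measurable X]setTI.
  exact: measurable_tuple_cons.
Qed.

HB.instance Definition _ := isMeasure.Build _ _ _ cons_law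
  cons_law0 cons_law_ge0 cons_law_sigma_additive.

Let cons_law_setT : cons_law [set: n.+1.-tuple T] = 1%E.
Proof.
rewrite /cons_law /pushforward preimage_setT -setXTT product_measure1E//.
by rewrite [X in (X * _)%E](probability_setT P)
  [X in (_ * X)%E](probability_setT Q) mule1.
Qed.

HB.instance Definition _ := Measure_isProbability.Build _ _ _ cons_law
  cons_law_setT.

Definition cons_probability : probability (n.+1.-tuple T) R := cons_law.

End step.

(* Law of a tuple of independent coordinates, the [i]-th one with law [P i];
   [product_lawE] below is its characterization on measurable boxes. *)
Fixpoint product_law (n : nat) : ('I_n -> probability T R) ->
    probability (n.-tuple T) R :=
  match n return ('I_n -> probability T R) -> probability (n.-tuple T) R with
  | 0 => fun _ => dirac [tuple]
  | n'.+1 => fun P =>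
      cons_probability (P ord0) (product_law (fun i => P (lift ord0 i)))
  end.

Lemma product_lawE (n : nat) (P : 'I_n -> probability T R)
    (A : 'I_n -> set T) : (forall i, measurable (A i)) ->
  product_law P [set z | forall i, A i (tnth z i)] = (\prod_(i < n) P i (A i))%E.
Proof.
elim: n P A => [|n IHn] P A mA.
  rewrite big_ord0 /= diracE mem_set//= => -[]//.
rewrite big_ord_recl -(IHn (fun i => P (lift ord0 i)) (fun i => A (lift ord0 i)))//.
rewrite /= /cons_law /pushforward -product_measure1E//; last first.
  rewrite (_ : mkset _ =
      \bigcap_(i in [set: 'I_n]) ((fun z => tnth z i) @^-1` A (lift ord0 i))).
    apply: fin_bigcap_measurable => // i _.
    by rewrite -[X in measurable X]setTI; exact: measurable_tnth.
  by apply/seteqP; split=> [z Az i _|z Az i]; [exact: Az|exact: (Az i)].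
congr (_ _); apply/seteqP; split=> [[x z] /= Axz|[x z] /= [Ax Az] i].
  split; first exact: (Axz ord0).
  by move=> i; have := Axz (lift ord0 i); rewrite tnthS.
by case: (unliftP ord0 i) => [j ->|->//]; rewrite tnthS.
Qed.

End product_law.

(* Periods are numbered 1, ..., T; the values of the fields (and of policies,
   counts and boundaries below) at other indices are irrelevant. *)
Record lost_sales (R : realType) (T : nat) := LostSales {
  demand_law : nat -> probability R R ;
  holding : nat -> R ;
  shortage : nat -> R ;
  demand_bound : R ;
  demand_supported : forall t, (1 <= t <= T)%N ->
    demand_law t `[0, demand_bound]%classic = 1%E ;
  holding_gt0 : forall t, (1 <= t <= T)%N -> 0 < holding t ;
  shortage_gt0 : forall t, (1 <= t <= T)%N -> 0 < shortage t }.

Section policies.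
Context {R : realType} {T : nat}.

Definition period_cost (I : lost_sales R T) (t : nat) (y d : R) : R :=
  holding I t * Num.max (y - d) 0 + shortage I t * Num.max (d - y) 0.

(* What one past period reveals: (inventory, post-order level, sales). *)
Definition observation : Type := R * R * R.

(* [pi n h x] is the law of the post-order level chosen in period [n.+1] from
   inventory [x], after the observations [h] of the [n] past periods, most
   recent first. *)
Definition policy : Type :=
  forall n : nat, n.-tuple observation -> R -> probability R R.

Definition feasible : set policy := [set pi | forall n, (n < T)%N ->
  measurable_fun [set: n.-tuple observation * R]
    (fun p => pi n p.1 p.2 : pprobability R R) /\
  forall h x, 0 <= x -> pi n h x `[x, +oo[%classic = 1%E].

(* Expected cost of the [k] periods [n.+1], ..., [n + k]. *)
Fixpoint expected_cost (I : lost_sales R T) (pi : policy) (k n : nat)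
    (h : n.-tuple observation) (x : R) : \bar R :=
  if k is k'.+1 then
    (\int[pi n h x]_y \int[demand_law I n.+1]_d
       ((period_cost I n.+1 y d)%:E +
        expected_cost I pi k' [tuple of (x, y, Num.min d y) :: h]
          (Num.max (y - d) 0)%R))%E
  else 0%E.

Definition value (I : lost_sales R T) (pi : policy) (x : R) : \bar R :=
  expected_cost I pi T [tuple] x.

Definition optimal_value (I : lost_sales R T) (x : R) : \bar R :=
  ereal_inf [set value I pi x | pi in feasible].

Definition eps_optimal (I : lost_sales R T) (eps : R) (pi : policy) : Prop :=
  feasible pi /\ (value I pi 0 - optimal_value I 0 <= eps%:E)%E.

End policies.
Arguments observation R : clear implicits.
Arguments policy R : clear implicits.
Arguments feasible R T : clear implicits.

Section logs.
Context {R : realType} {T : nat}.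

(* [Tagged _ j] with tag [i : 'I_T] is log [j] of period [i.+1]. *)
Definition slot (N : nat -> nat) : finType := {i : 'I_T & 'I_(N i.+1)}.

(* A log array, flattened along the enumeration of [slot N]. *)
Definition logs (N : nat -> nat) : Type := #|slot N|.-tuple R.

Definition boundaries (N : nat -> nat) : Type := forall t : nat, 'I_(N t) -> R.

Definition latent_law (I : lost_sales R T) (N : nat -> nat) :
    probability (logs N) R :=
  product_law (fun k : 'I_#|slot N| => demand_law I (tag (enum_val k)).+1).

Definition censor (N : nat -> nat) (b : boundaries N) (z : logs N) : logs N :=
  [tuple Num.min (tnth z k) (b (tag (enum_val k)).+1 (tagged (enum_val k)))
    | k < #|slot N|].

(* The randomization of an algorithm is an independent seed in [W]. *)
Definition algorithm (N : nat -> nat) (W : Type) : Type :=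
  logs N -> W -> policy R.

Definition measurable_algorithm (N : nat -> nat) (d : measure_display)
    (W : measurableType d) (A : algorithm N W) : Prop :=
  forall n, (n < T)%N ->
  measurable_fun [set: (logs N * W) * (n.-tuple (observation R) * R)]
    (fun p => A p.1.1 p.1.2 n p.2.1 p.2.2 : pprobability R R).

(* The algorithm returns an [eps]-optimal policy with probability at least
   [delta]: the set of such (logs, seed) contains a measurable event [E] with
   at least that probability. *)
Definition succeeds (N : nat -> nat) (b : boundaries N) (d : measure_display)
    (W : measurableType d) (Q : probability W R) (A : algorithm N W)
    (eps delta : R) (I : lost_sales R T) : Prop :=
  exists2 E : set (logs N * W),
    measurable E /\ E `<=` [set p | eps_optimal I eps (A p.1 p.2)] &
    (delta%:E <= (latent_law I N \x Q) [set p | E (censor b p.1, p.2)])%E.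

End logs.
Arguments slot T N : clear implicits.
Arguments logs R T N : clear implicits.
Arguments boundaries R N : clear implicits.
Arguments algorithm R T N W : clear implicits.

(* Main.v *)
(**
Each odd period hides one sign: its demand is 1/4 or 3/4 with probabilities
1/2 + delta and 1/2 - delta, in an order given by the sign, where
delta = 16 eps / K; ordering for the wrong demand costs delta more than the optimum.
Each even period clears the stock, so the optimal cost is the sum of the one-period
optima, and the regret of any policy is at least delta times the sum over i of its
expected mistake in the i-th odd period.  The level chosen there depends only on the
earlier demands, hence the mistakes under a sign vector and under its flip at i add
up to 1.

Only the logs with boundary 7/8 tell the two signs of an odd period apart, each with
squared Hellinger affinity 1 - 4 delta^2.  Hence, for n_i such logs, the expected
mistakes of the learned policy under the two sign vectors add up to at least
3/4 - 12 n_i delta^2.  On success the total mistake is at most K/16, and averaging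
over all sign vectors gives K <= 96 delta^2 (n_1 + ... + n_K), where
n_1 + ... + n_K <= r M.
*)

Require Import Defs.
From HB Require Import structures.
From mathcomp Require Import all_boot all_order all_algebra.
From mathcomp Require Import all_classical all_reals all_analysis.
From mathcomp Require Import measurable_realfun.
From mathcomp Require Import ring lra.

Set Implicit Arguments.
Unset Strict Implicit.
Unset Printing Implicit Defensive.

Import Order.TTheory GRing.Theory Num.Theory.
Import numFieldNormedType.Exports.

Local Open Scope classical_set_scope.
Local Open Scope ring_scope.

(** * Independent two-point laws *)

Section two_point_law.
Context {R : realType}.

Definition atom (a b : R) (c : bool) : R := if c then a else b.

Lemma measurable_atom (a b : R) : measurable_fun [set: bool] (atom a b).
Proof. by []. Qed.

Definition atom_mfun (a b : R) : {mfun bool >-> R} :=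
  mfun_Sub (mem_set (measurable_atom a b)).

Definition two_point (p a b : R) : probability R R :=
  distribution (bernoulli_prob p) (atom_mfun a b).

Lemma integral_two_point (p a b : R) (f : R -> \bar R) : 0 <= p <= 1 ->
  measurable_fun [set: R] f -> (forall x, 0 <= f x)%E ->
  (\int[two_point p a b]_x f x = p%:E * f a + (1 - p)%:E * f b)%E.
Proof.
move=> p01 mf f0; rewrite /two_point ge0_integral_distribution//.
by rewrite integral_bernoulli_prob// => x; exact: f0.
Qed.

Lemma two_pointE (p a b : R) (A : set R) : 0 <= p <= 1 ->
  (two_point p a b A = p%:E * \d_a A + (1 - p)%:E * \d_b A)%E.
Proof.
move=> p01; rewrite /two_point/= /distribution /pushforward bernoulli_probE//.
Qed.
End two_point_law.

Section two_point_product.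
Context {R : realType}.

(** Expectation over independent coordinates equal to [a i] with probability [p i] and to [b i]
    otherwise. Being a finite real sum, it is linear without measurability conditions. *)
Fixpoint expect (n : nat) :
    ('I_n -> R) -> ('I_n -> R) -> ('I_n -> R) -> (n.-tuple R -> R) -> R :=
  match n return ('I_n -> R) -> ('I_n -> R) -> ('I_n -> R) ->
      (n.-tuple R -> R) -> R with
  | 0 => fun _ _ _ f => f [tuple]
  | n'.+1 => fun p a b f =>
      let E x := expect (fun i => p (lift ord0 i)) (fun i => a (lift ord0 i))
        (fun i => b (lift ord0 i)) (fun z => f [tuple of x :: z]) in
      p ord0 * E (a ord0) + (1 - p ord0) * E (b ord0)
  end.

Lemma expect_ge0 (n : nat) (p a b : 'I_n -> R) (f : n.-tuple R -> R) :
  (forall i, 0 <= p i <= 1) -> (forall z, 0 <= f z) -> 0 <= expect p a b f.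
Proof.
elim: n p a b f => [|n IH] p a b f p01 f0 //=.
have /andP[p0 p1] := p01 ord0.
by rewrite addr_ge0// mulr_ge0 ?subr_ge0//; apply: IH.
Qed.

Lemma expectD (n : nat) (p a b : 'I_n -> R) (f g : n.-tuple R -> R) :
  expect p a b (fun z => f z + g z) = expect p a b f + expect p a b g.
Proof.
elim: n p a b f g => [|n IH] p a b f g //=.
by rewrite !IH; ring.
Qed.

Lemma expectZ (n : nat) (p a b : 'I_n -> R) (c : R) (f : n.-tuple R -> R) :
  expect p a b (fun z => c * f z) = c * expect p a b f.
Proof. by elim: n p a b f => [|n IH] p a b f //=; rewrite !IH; ring. Qed.

Lemma expect_cst (n : nat) (p a b : 'I_n -> R) (c : R) :
  expect p a b (fun=> c) = c.
Proof.
by elim: n p a b => [|n IH] p a b //=; rewrite !IH; ring.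
Qed.

Lemma eq_expect (n : nat) (p a b : 'I_n -> R) (f g : n.-tuple R -> R) :
  f =1 g -> expect p a b f = expect p a b g.
Proof.
elim: n p a b f g => [|n IH] p a b f g fg //=.
by congr (_ * _ + _ * _); apply: IH => z; exact: fg.
Qed.

Lemma le_expect (n : nat) (p a b : 'I_n -> R) (f g : n.-tuple R -> R) :
  (forall i, 0 <= p i <= 1) -> (forall z, f z <= g z) ->
  expect p a b f <= expect p a b g.
Proof.
move=> p01 fg; rewrite -subr_ge0 -[X in _ - X]mul1r -mulNr -expectZ -expectD.
by apply: expect_ge0 => // z; rewrite mulN1r subr_ge0.
Qed.

Lemma measurable_expect d (X : measurableType d) (n : nat) (p a b : 'I_n -> R)
    (f : X -> n.-tuple R -> R) : (forall z, measurable_fun [set: X] (f ^~ z)) ->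
  measurable_fun [set: X] (fun x => expect p a b (f x)).
Proof.
elim: n p a b f => [|n IH] p a b f mf /=; first exact: mf.
by apply: measurable_funD; apply: measurable_funM => //; apply: IH.
Qed.

Lemma expect_sum (n : nat) (p a b : 'I_n -> R) (I : Type) (s : seq I)
    (f : I -> n.-tuple R -> R) :
  expect p a b (fun z => \sum_(i <- s) f i z) =
  \sum_(i <- s) expect p a b (f i).
Proof.
elim: s => [|i s IH].
  by rewrite big_nil -[RHS](expect_cst p a b); apply: eq_expect => z;
    rewrite big_nil.
rewrite big_cons -IH -expectD; apply: eq_expect => z; by rewrite big_cons.
Qed.

(** Induction on the length: a change of variables along [tuple_cons], then Tonelli with the tail
    integrated first. *)
Lemma integral_product_two_point (n : nat) (p a b : 'I_n -> R)
    (f : n.-tuple R -> R) : (forall i, 0 <= p i <= 1) ->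
  measurable_fun [set: n.-tuple R] f -> (forall z, 0 <= f z) ->
  (\int[product_law (fun i => two_point (p i) (a i) (b i))]_z (f z)%:E =
   (expect p a b f)%:E)%E.
Proof.
elim: n p a b f => [|n IH] p a b f p01 mf f0.
  by rewrite [LHS]integral_dirac//= ?diracT ?mul1e//; exact/measurable_EFinP.
pose Q : probability (n.-tuple R) R :=
  product_law (fun i => two_point (p (lift ord0 i)) (a (lift ord0 i))
    (b (lift ord0 i))).
pose F (q : R * n.-tuple R) : \bar R := (f (tuple_cons q))%:E.
have mF : measurable_fun [set: R * n.-tuple R] F.
  apply/measurable_EFinP; apply: measurableT_comp => //.
  exact: measurable_tuple_cons.
have F0 q : (0 <= F q)%E by rewrite lee_fin.
transitivity (\int[(two_point (p ord0) (a ord0) (b ord0) \x Q)%E]_q F q)%E.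
  rewrite [LHS](@ge0_integral_pushforward _ _ _ _ _ (@tuple_cons _ R n)
    _ _ setT (fun z => (f z)%:E)).
  - by rewrite preimage_setT.
  - exact: measurable_tuple_cons.
  - exact: measurableT.
  - exact/measurable_EFinP.
  - by move=> z _; rewrite lee_fin.
rewrite fubini_tonelli1//= /fubini_F integral_two_point//; last 2 first.
- exact: measurable_fun_fubini_tonelli_F.
- by move=> x; apply: integral_ge0 => z _.
have E x : (\int[Q]_z F (x, z) = (expect (fun i => p (lift ord0 i))
    (fun i => a (lift ord0 i)) (fun i => b (lift ord0 i))
    (fun z => f [tuple of x :: z]))%:E)%E.
  rewrite -IH//; apply: measurableT_comp => //.
  exact: measurable_cons.
by rewrite !E -!EFinM -EFinD.
Qed.
End two_point_product.

(** * Hellinger affinity *)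

Section affinity.
Context {R : realType}.

Lemma amgm_sqr (x y k : R) : 0 <= x -> 0 <= y -> 0 <= k -> k ^+ 2 <= x * y ->
  2 * k <= x + y.
Proof.
move=> x0 y0 k0 kxy; rewrite -(@ler_pXn2r _ 2) ?nnegrE ?addr_ge0 ?mulr_ge0//.
have := sqr_ge0 (x - y); nra.
Qed.

Lemma cross_product_ge (u v u' v' c : R) : 0 <= u -> 0 <= v -> 0 <= u' ->
  0 <= v' -> 0 <= c -> c <= u * v -> c <= u' * v' ->
  c ^+ 2 <= (u * v') * (u' * v).
Proof.
move=> u0 v0 u'0 v'0 c0 cuv cuv'.
rewrite [leRHS](_ : _ = (u * v) * (u' * v')); last by ring.
by rewrite expr2 ler_pM.
Qed.

(** Expand the product: [u v] and [u' v'] contribute [(p^2 + (1 - p)^2) c], and by AM-GM the cross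
    terms contribute at least [2 p (1 - p) c]. *)
Lemma same_law_affinity (p u v u' v' c : R) : 0 <= p <= 1 ->
  0 <= u -> 0 <= v -> 0 <= u' -> 0 <= v' -> 0 <= c ->
  c <= u * v -> c <= u' * v' ->
  c <= (p * u + (1 - p) * u') * (p * v + (1 - p) * v').
Proof.
move=> /andP[p0 p1] u0 v0 u'0 v'0 c0 cuv cuv'.
have h := amgm_sqr (mulr_ge0 u0 v'0) (mulr_ge0 u'0 v0) c0
  (cross_product_ge u0 v0 u'0 v'0 c0 cuv cuv').
have q0 : 0 <= 1 - p by rewrite subr_ge0.
have h1 := ler_wpM2l (mulr_ge0 p0 q0) h.
have h2 := ler_wpM2l (mulr_ge0 p0 p0) cuv.
have h3 := ler_wpM2l (mulr_ge0 q0 q0) cuv'.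
lra.
Qed.

(** [4 p (1 - p)] is the squared Hellinger affinity of the Bernoulli laws of parameters [p] and
    [1 - p]. One half comes from [u v] and [u' v'], the other from AM-GM on the cross terms. *)
Lemma swapped_law_affinity (p u v u' v' c : R) : 0 <= p <= 1 ->
  0 <= u -> 0 <= v -> 0 <= u' -> 0 <= v' -> 0 <= c ->
  c <= u * v -> c <= u' * v' ->
  4 * p * (1 - p) * c <= (p * u + (1 - p) * u') * ((1 - p) * v + p * v').
Proof.
move=> /andP[p0 p1] u0 v0 u'0 v'0 c0 cuv cuv'.
have q0 : 0 <= 1 - p by rewrite subr_ge0.
have h : 2 * (p * (1 - p) * c) <= p ^+ 2 * (u * v') + (1 - p) ^+ 2 * (u' * v).
  apply: amgm_sqr; rewrite ?mulr_ge0 ?sqr_ge0//.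
  have := ler_wpM2l (sqr_ge0 (p * (1 - p)))
    (cross_product_ge u0 v0 u'0 v'0 c0 cuv cuv').
  lra.
have h2 := ler_wpM2l (mulr_ge0 p0 q0) cuv.
have h3 := ler_wpM2l (mulr_ge0 p0 q0) cuv'.
lra.
Qed.

(* Tensorization of the Hellinger affinity, stated without densities: the
   squared affinity of two laws is the infimum of [E f * E g] over [f * g >= 1].
   The third alternative is an observation that is constant, hence blind. *)
Lemma expect_affinity (n : nat) (p q a b beta : 'I_n -> R)
    (f g : n.-tuple R -> R) (c : R) :
  (forall i, 0 <= p i <= 1) -> (forall i, 0 <= beta i) ->
  (forall i, [\/ q i = p i /\ beta i = 1,
                 q i = 1 - p i /\ beta i = 4 * p i * (1 - p i) |
                 [/\ a i = b i, beta i = 1 & 0 <= q i <= 1]]) ->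
  (forall z, 0 <= f z) -> (forall z, 0 <= g z) -> 0 <= c ->
  (forall z, c <= f z * g z) ->
  (\prod_i beta i) * c <= expect p a b f * expect q a b g.
Proof.
elim: n p q a b beta f g c => [|n IH] p q a b beta f g c p01 beta0 H f0 g0 c0.
  by rewrite big_ord0 mul1r => fg; exact: fg.
move=> fg.
have q01 i : 0 <= q i <= 1.
  have /andP[p0 p1] := p01 i.
  by case: (H i) => [[-> _]|[-> _]|[]]//; apply/andP; split; lra.
rewrite big_ord_recl /=.
set B := \prod_(i < n) beta (lift ord0 i).
have B0 : 0 <= B by apply: prodr_ge0.
pose tl (h : 'I_n.+1 -> R) i := h (lift ord0 i).
pose F x := expect (tl p) (tl a) (tl b) (fun z => f [tuple of x :: z]).
pose G x := expect (tl q) (tl a) (tl b) (fun z => g [tuple of x :: z]).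
have FG x : B * c <= F x * G x.
  apply: (IH (tl p) (tl q) (tl a) (tl b) (tl beta)) => // i.
  - exact: p01.
  - exact: beta0.
  - exact: H.
have F0 x : 0 <= F x by apply: expect_ge0 => // i; exact: p01.
have G0 x : 0 <= G x by apply: expect_ge0 => // i; exact: q01.
have Bc0 : 0 <= B * c by rewrite mulr_ge0.
rewrite -/(F (a ord0)) -/(F (b ord0)) -/(G (a ord0)) -/(G (b ord0)) -mulrA.
case: (H ord0) => [[-> ->]|[-> ->]|[<- -> _]].
- by rewrite mul1r same_law_affinity.
- rewrite subKr; exact: swapped_law_affinity.
- by rewrite mul1r -!mulrDl [p _ + _]addrC [q _ + _]addrC !subrK !mul1r.
Qed.

(** The upper bound drives the induction for the lower one: [b P >= P - (1 - b)] when [P <= 1]. *)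
Lemma prod_ge_subr_sum (n : nat) (beta : 'I_n -> R) :
  (forall i, 0 <= beta i <= 1) ->
  1 - \sum_i (1 - beta i) <= \prod_i beta i <= 1.
Proof.
elim: n beta => [|n IH] beta b01; first by rewrite !big_ord0; lra.
rewrite !big_ord_recl.
have /andP[h1 h2] := IH _ (fun i => b01 (lift ord0 i)).
have /andP[b0 b1] := b01 ord0.
have P0 : 0 <= \prod_(i < n) beta (lift ord0 i).
  by apply: prodr_ge0 => i _; case/andP: (b01 (lift ord0 i)).
set P := \prod_(i < n) _ in h1 h2 P0 *; set S := \sum_(i < n) _ in h1 *.
by apply/andP; split; nra.
Qed.

(** [phi] is a randomized test between two product laws. The bound on the sum of its two errors
    comes directly from the affinity, without passing through total variation. *)
Lemma expect_testing (n : nat) (p q a b beta : 'I_n -> R)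
    (phi : n.-tuple R -> R) :
  (forall i, 0 <= p i <= 1) -> (forall i, 0 <= beta i <= 1) ->
  (forall i, [\/ q i = p i /\ beta i = 1,
                 q i = 1 - p i /\ beta i = 4 * p i * (1 - p i) |
                 [/\ a i = b i, beta i = 1 & 0 <= q i <= 1]]) ->
  (forall z, 0 <= phi z <= 1) ->
  3 / 4 - 3 * \sum_i (1 - beta i) <=
    expect p a b phi + expect q a b (fun z => 1 - phi z).
Proof.
move=> p01 beta01 H phi01.
have q01 i : 0 <= q i <= 1.
  have /andP[p0 p1] := p01 i.
  by case: (H i) => [[-> _]|[-> _]|[]]//; apply/andP; split; lra.
have S0 : 0 <= \sum_i (1 - beta i).
  by apply: sumr_ge0 => i _; rewrite subr_ge0; case/andP: (beta01 i).
have X0 : 0 <= expect p a b phi.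
  by apply: expect_ge0 => // z; case/andP: (phi01 z).
have Y0 : 0 <= expect q a b (fun z => 1 - phi z).
  by apply: expect_ge0 => // z; rewrite subr_ge0; case/andP: (phi01 z).
have /andP[B1 _] := prod_ge_subr_sum beta01.
have : (\prod_i beta i) * 2 <= (expect p a b phi + 1) *
    (expect q a b (fun z => 1 - phi z) + 1).
  (* (1 + phi) * (2 - phi) >= 2 on [0, 1] *)
  have <- : expect p a b (fun z => phi z + 1) = expect p a b phi + 1.
    by rewrite expectD expect_cst.
  have <- : expect q a b (fun z => (1 - phi z) + 1) =
      expect q a b (fun z => 1 - phi z) + 1 by rewrite expectD expect_cst.
  apply: expect_affinity => //.
  - by move=> i; case/andP: (beta01 i).
  - by move=> z; have := phi01 z; lra.
  - by move=> z; have := phi01 z; lra.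
  - by move=> z; have := phi01 z; nra.
set X := expect _ _ _ _ in X0 *; set Y := expect _ _ _ _ in Y0 *.
set S := \sum_i _ in S0 B1 *; set P := \prod_i _ in B1 * => XY.
(* Otherwise AM-GM gives [8 (1 - S) <= (X + Y + 2)^2 < (11/4 - 3 S)^2], which fails for
   [0 <= S < 1/4]; here [S < 1/4] because [X + Y >= 0]. *)
have [|lt] := lerP (3 / 4 - 3 * S) (X + Y) => //.
have : (X + 1) * (Y + 1) * 4 <= (X + Y + 2) ^+ 2.
  by have := sqr_ge0 (X - Y); nra.
nra.
Qed.
End affinity.

(** * Expected costs under two-point demands *)

Section mixture.
Context {R : realType}.

Definition mix (p : R) (a b : \bar R) : \bar R := (p%:E * a + (1 - p)%:E * b)%E.

Lemma mix_ge0 (p : R) (a b : \bar R) :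
  0 <= p <= 1 -> (0 <= a)%E -> (0 <= b)%E -> (0 <= mix p a b)%E.
Proof.
by move=> /andP[p0 p1] a0 b0; rewrite adde_ge0// mule_ge0// lee_fin subr_ge0.
Qed.

Lemma le_mix (p : R) (a b a' b' : \bar R) : 0 <= p <= 1 ->
  (a <= a')%E -> (b <= b')%E -> (mix p a b <= mix p a' b')%E.
Proof.
move=> /andP[p0 p1] aa' bb'.
by apply: leeD; apply: lee_wpmul2l; rewrite // lee_fin subr_ge0.
Qed.

Lemma mixEFin (p a b : R) : mix p a%:E b%:E = (p * a + (1 - p) * b)%:E.
Proof. by rewrite /mix -!EFinM -EFinD. Qed.

Lemma mix_compl (p : R) (a b a' b' : \bar R) :
  (0 <= a)%E -> (0 <= b)%E -> (0 <= a')%E -> (0 <= b')%E ->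
  (a + a' = 1 -> b + b' = 1 -> mix p a b + mix p a' b' = 1)%E.
Proof.
case: a b a' b' => [a| |] [b| |] [a'| |] [b'| |]//= _ _ _ _ [aa] [bb].
rewrite !mixEFin -EFinD; congr EFin.
transitivity (p * (a + a') + (1 - p) * (b + b')); first by ring.
by rewrite aa bb; ring.
Qed.

Lemma measurable_mix d (X : measurableType d) (p : R) (f g : X -> \bar R) :
  measurable_fun [set: X] f -> measurable_fun [set: X] g ->
  measurable_fun [set: X] (fun x => mix p (f x) (g x)).
Proof.
by move=> mf mg; apply: emeasurable_funD; apply: measurable_funeM.
Qed.

End mixture.

Section dynamics.
Context {R : realType} {T : nat} {dTh : measure_display}.
Context {Th : measurableType dTh}.
Variable pi : Th -> policy R.
Arguments pi : clear implicits.
Hypothesis mpi : forall n, (n < T)%N ->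
  measurable_fun [set: Th * (n.-tuple (observation R) * R)]
    (fun p => pi p.1 n p.2.1 p.2.2 : pprobability R R).

(** States carry the parameter of the policy: the pair of logs and seed for an algorithm, a point of
    [unit] for a single policy. *)
Let state (n : nat) : measurableType _ :=
  (Th * (n.-tuple (observation R) * R))%type.

Definition next (n : nat) (q : (Th * (n.-tuple (observation R) * R)) * R)
    (d : R) : Th * (n.+1.-tuple (observation R) * R) :=
  (q.1.1, ([tuple of (q.1.2.2, q.2, Num.min d q.2) :: q.1.2.1],
           Num.max (q.2 - d) 0)).

Lemma measurable_next (n : nat) :
  measurable_fun [set: (state n * R) * R] (fun r => next r.1 r.2).
Proof.
have mq : measurable_fun [set: (state n * R) * R] (fun r => r.1.1.2).
  exact: (measurableT_comp measurable_snd
    (measurableT_comp measurable_fst measurable_fst)).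
have my : measurable_fun [set: (state n * R) * R] (fun r => r.1.2).
  exact: (measurableT_comp measurable_snd measurable_fst).
apply: measurable_fun_pair => /=.
  exact: (measurableT_comp measurable_fst
    (measurableT_comp measurable_fst measurable_fst)).
apply: measurable_fun_pair => /=; last first.
  by apply: measurable_maxr => //; exact: measurable_funB.
apply: (@measurable_cons _ _ _ (observation R)
    (fun r : (state n * R) * R => (r.1.1.2.2, r.1.2, Num.min r.2 r.1.2))
    n (fun r => r.1.1.2.1)).
  apply: measurable_fun_pair => /=; last exact: measurable_minr.
  apply: measurable_fun_pair => //=.
  exact: (measurableT_comp measurable_snd mq).
exact: (measurableT_comp measurable_fst mq).
Qed.

Lemma measurable_integral_policy (n : nat) (f : state n * R -> \bar R) :
  (n < T)%N -> measurable_fun [set: state n * R] f -> (forall r, 0 <= f r)%E ->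
  measurable_fun [set: state n]
    (fun p => \int[pi p.1 n p.2.1 p.2.2]_y f (p, y))%E.
Proof.
move=> nT mf f0.
exact: (measurable_fun_integral_finite_kernel f (kprobability (mpi nT))).
Qed.

Lemma period_cost_ge0 (I : lost_sales R T) (t : nat) (y d : R) :
  (1 <= t <= T)%N -> 0 <= period_cost I t y d.
Proof.
move=> tT; rewrite /period_cost addr_ge0// mulr_ge0 ?le_max ?lexx ?orbT//.
  by rewrite ltW// holding_gt0.
by rewrite ltW// shortage_gt0.
Qed.

Lemma expected_cost_ge0 (I : lost_sales R T) (rho : policy R) (k n : nat) h x :
  (n + k <= T)%N -> (0 <= expected_cost I rho k (n := n) h x)%E.
Proof.
elim: k n h x => [|k IH] n h x nkT //=.
apply: integral_ge0 => y _; apply: integral_ge0 => d _.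
apply: adde_ge0; last by apply: IH; rewrite addSnnS.
by rewrite lee_fin period_cost_ge0//= (leq_trans _ nkT)// addnS ltnS leq_addr.
Qed.

(** The integrand of [expected_cost], taken jointly in state, level and demand so that Tonelli
    yields the measurability of its partial integrals. *)
Definition stage_cost (I : lost_sales R T) (k n : nat)
    (r : (state n * R) * R) : \bar R :=
  ((period_cost I n.+1 r.1.2 r.2)%:E +
   expected_cost I (pi r.1.1.1) k (next r.1 r.2).2.1 (next r.1 r.2).2.2)%E.

Lemma stage_cost_ge0 (I : lost_sales R T) (k n : nat) r :
  (n + k.+1 <= T)%N -> (0 <= @stage_cost I k n r)%E.
Proof.
move=> nkT; apply: adde_ge0; last by apply: expected_cost_ge0; rewrite addSnnS.
by rewrite lee_fin period_cost_ge0//= (leq_trans _ nkT)// addnS ltnS leq_addr.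
Qed.

(** Isolated because the measurability of stage costs and that of expected costs are proved from
    each other by recursion on the horizon. *)
Lemma measurable_stage_cost_step (I : lost_sales R T) (k n : nat) :
  measurable_fun [set: state n.+1]
    (fun p => expected_cost I (pi p.1) k p.2.1 p.2.2) ->
  measurable_fun [set: (state n * R) * R] (@stage_cost I k n).
Proof.
move=> mE; apply: emeasurable_funD.
  apply/measurable_EFinP; rewrite /period_cost.
  have my : measurable_fun [set: (state n * R) * R] (fun r => r.1.2).
    exact: (measurableT_comp measurable_snd measurable_fst).
  apply: measurable_funD; apply: measurable_funM => //;
    by apply: measurable_maxr => //; exact: measurable_funB.
exact: (measurableT_comp mE (@measurable_next n)).
Qed.

Lemma measurable_expected_cost (I : lost_sales R T) (k n : nat) :
  (n + k <= T)%N -> measurable_fun [set: state n]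
    (fun p => expected_cost I (pi p.1) k p.2.1 p.2.2).
Proof.
elim: k n => [|k IH] n nkT //=.
have mS : measurable_fun [set: (state n * R) * R] (@stage_cost I k n).
  by apply: measurable_stage_cost_step; apply: IH; rewrite addSnnS.
apply: (@measurable_integral_policy n
  (fun q => \int[demand_law I n.+1]_d stage_cost I k (q, d))%E).
- by rewrite (leq_trans _ nkT)// addnS ltnS leq_addr.
- by apply: measurable_fun_fubini_tonelli_F => // r; exact: stage_cost_ge0.
- by move=> q; apply: integral_ge0 => d _; exact: stage_cost_ge0.
Qed.

Lemma measurable_stage_cost (I : lost_sales R T) (k n : nat) :
  (n + k.+1 <= T)%N ->
  measurable_fun [set: (state n * R) * R] (@stage_cost I k n).
Proof.
move=> nkT; apply: measurable_stage_cost_step.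
apply: measurable_expected_cost.
by rewrite addSnnS.
Qed.

Variables w lo hi : nat -> R.
Hypothesis w01 : forall t, 0 <= w t <= 1.

(* The law of the level of period [n + j + 1] does not involve the demand of
   that period, nor any later one. *)
Fixpoint level_expect (v : nat -> R) (rho : policy R) (u : R -> R) (j n : nat)
    (h : n.-tuple (observation R)) (x : R) : \bar R :=
  if j is j'.+1 then
    (\int[rho n h x]_y
      let after d := level_expect v rho u j' [tuple of (x, y, Num.min d y) :: h]
        (Num.max (y - d) 0)%R in
      mix (v n.+1) (after (lo n.+1)) (after (hi n.+1)))%E
  else (\int[rho n h x]_y (u y)%:E)%E.

Lemma eq_level_expect (v v' : nat -> R) rho u j n h x :
  (forall t, (n < t <= n + j)%N -> v t = v' t) ->
  level_expect v rho u j (n := n) h x = level_expect v' rho u j h x.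
Proof.
elim: j n h x => [|j IH] n h x vv' //=.
have vv'' t : (n.+1 < t <= n.+1 + j)%N -> v t = v' t.
  by move=> /andP[nt tj]; apply: vv'; rewrite (ltnW nt) -addSnnS.
apply: eq_integral => y _; rewrite !(IH _ _ _ vv'').
by congr (mix _ _ _); apply: vv'; rewrite ltnSn addnS ltnS leq_addr.
Qed.

Lemma level_expect_ge0 rho u j n h x : (forall y, 0 <= u y) ->
  (0 <= level_expect w rho u j (n := n) h x)%E.
Proof.
move=> u0; elim: j n h x => [|j IH] n h x /=; apply: integral_ge0 => y _.
  by rewrite lee_fin.
exact: mix_ge0.
Qed.

Let after_level (u : R -> R) (j n : nat) (q : state n * R) (d : R) : \bar R :=
  level_expect w (pi q.1.1) u j (next q d).2.1 (next q d).2.2.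

Let measurable_after (u : R -> R) (j n : nat) (d : R) :
  measurable_fun [set: state n.+1]
    (fun p => level_expect w (pi p.1) u j p.2.1 p.2.2) ->
  measurable_fun [set: state n * R] (fun q => after_level u j q d).
Proof.
move=> mL; apply: (measurableT_comp (f := fun p : state n.+1 =>
   level_expect w (pi p.1) u j p.2.1 p.2.2) (g := fun q => next q d)) => //.
exact: (measurableT_comp (@measurable_next n) (pair2_measurable d)).
Qed.

Lemma measurable_level_expect (u : R -> R) (j n : nat) :
  measurable_fun [set: R] u -> (forall y, 0 <= u y) -> (n + j < T)%N ->
  measurable_fun [set: state n]
    (fun p => level_expect w (pi p.1) u j p.2.1 p.2.2).
Proof.
move=> mu u0; elim: j n => [|j IH] n njT /=.
  apply: (@measurable_integral_policy n (fun q => (u q.2)%:E)).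
  - by rewrite addn0 in njT.
  - by apply/measurable_EFinP; apply: measurableT_comp.
  - by move=> q; rewrite lee_fin.
have mL := IH n.+1; rewrite addSnnS in mL; have {}mL := mL njT.
apply: (@measurable_integral_policy n (fun q =>
  mix (w n.+1) (after_level u j q (lo n.+1)) (after_level u j q (hi n.+1)))).
- by rewrite (leq_ltn_trans _ njT)// leq_addr.
- by apply: measurable_mix; exact: measurable_after.
- by move=> q; apply: mix_ge0; rewrite ?level_expect_ge0.
Qed.

Let measurable_section n (f : state n * R -> \bar R) (p : state n) :
  measurable_fun [set: state n * R] f ->
  measurable_fun [set: R] (fun y => f (p, y)).
Proof. by move=> mf; exact: (measurableT_comp mf (pair1_measurable p)). Qed.

Let measurable_mix_after (u : R -> R) (j n : nat) (p : state n) :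
  measurable_fun [set: R] u -> (forall y, 0 <= u y) -> (n.+1 + j < T)%N ->
  measurable_fun [set: R] (fun y => mix (w n.+1)
    (after_level u j (p, y) (lo n.+1)) (after_level u j (p, y) (hi n.+1))).
Proof.
move=> mu u0 njT.
apply: (@measurable_section n (fun q => mix (w n.+1)
    (after_level u j q (lo n.+1)) (after_level u j q (hi n.+1))) p).
by apply: measurable_mix; apply: measurable_after;
  exact: measurable_level_expect.
Qed.

(** Every stage is linear in [u] and preserves the constant 1. This makes the mistakes under
    opposite signs complementary, and it also yields finiteness. *)
Lemma level_expect_compl (u : R -> R) (j n : nat) th h x :
  measurable_fun [set: R] u -> (forall y, 0 <= u y <= 1) -> (n + j < T)%N ->
  (level_expect w (pi th) u j (n := n) h x +
   level_expect w (pi th) (fun y => 1 - u y)%R j h x = 1)%E.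
Proof.
move=> mu u01.
have u0 y : 0 <= u y by case/andP: (u01 y).
have u'0 y : 0 <= 1 - u y by rewrite subr_ge0; case/andP: (u01 y).
have mu' : measurable_fun [set: R] (fun y => 1 - u y) by exact: measurable_funB.
elim: j n h x => [|j IH] n h x njT /=.
  rewrite -ge0_integralD//=; last 4 first.
  - by move=> y _; rewrite lee_fin.
  - exact/measurable_EFinP.
  - by move=> y _; rewrite lee_fin.
  - exact/measurable_EFinP.
  under eq_integral do rewrite -EFinD addrC subrK.
  by rewrite integral_cst// mul1e; exact: probability_setT.
have njT' : (n.+1 + j < T)%N by rewrite addSnnS.
rewrite -ge0_integralD//=; last 4 first.
- by move=> y _; apply: mix_ge0 => //; exact: level_expect_ge0.
- exact: (@measurable_mix_after u j n (th, (h, x))).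
- by move=> y _; apply: mix_ge0 => //; exact: level_expect_ge0.
- exact: (@measurable_mix_after (fun y => 1 - u y) j n (th, (h, x))).
under eq_integral => y _.
  rewrite mix_compl ?level_expect_ge0//; first over; exact: IH.
by rewrite integral_cst// mul1e; exact: probability_setT.
Qed.

Lemma level_expect_fin_num (u : R -> R) (j n : nat) th h x :
  measurable_fun [set: R] u -> (forall y, 0 <= u y <= 1) -> (n + j < T)%N ->
  level_expect w (pi th) u j (n := n) h x \is a fin_num.
Proof.
move=> mu u01 njT; have u0 y : 0 <= u y by case/andP: (u01 y).
rewrite ge0_fin_numE ?level_expect_ge0//.
apply: (@le_lt_trans _ _ 1%E); last exact: ltry.
rewrite -(level_expect_compl th h x mu u01 njT) leeDl// level_expect_ge0// => y.
by rewrite subr_ge0; case/andP: (u01 y).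
Qed.

Variable I : lost_sales R T.
Hypothesis demandI : forall t, demand_law I t = two_point (w t) (lo t) (hi t).

Lemma expected_costS (k n : nat) th h x : (n + k.+1 <= T)%N ->
  (expected_cost I (pi th) k.+1 (n := n) h x =
   \int[pi th n h x]_y mix (w n.+1)
     (stage_cost I k (((th, (h, x)), y), lo n.+1))
     (stage_cost I k (((th, (h, x)), y), hi n.+1)))%E.
Proof.
move=> nkT /=; apply: eq_integral => y _; rewrite demandI.
rewrite (@integral_two_point R _ _ _
  (fun d => stage_cost I k (((th, (h, x)), y), d)))//.
- exact: (measurableT_comp (measurable_stage_cost I nkT)
    (pair1_measurable ((th, (h, x)), y))).
- by move=> d; exact: stage_cost_ge0.
Qed.

Let measurable_stage_section (k n : nat) (p : state n) (d : R) :
  (n + k.+1 <= T)%N ->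
  measurable_fun [set: R] (fun y => stage_cost I k ((p, y), d)).
Proof.
move=> nkT; apply: (@measurable_section n (fun q => stage_cost I k (q, d))).
exact: (measurableT_comp (measurable_stage_cost I nkT) (pair2_measurable d)).
Qed.

(** The level is chosen before its demand is drawn, so after any history a period costs on average
    at least its floor [mc] plus [delta] times the loss of the level. Induction on the horizon adds
    these bounds up along the policy. *)
Lemma le_expected_cost (delta : R) (mc : nat -> R) (u : nat -> R -> R) :
  0 <= delta -> (forall t, 0 <= mc t) ->
  (forall t, measurable_fun [set: R] (u t)) ->
  (forall t y, 0 <= u t y <= 1) ->
  (forall t y, (1 <= t <= T)%N -> mc t + delta * u t y <=
    w t * period_cost I t y (lo t) + (1 - w t) * period_cost I t y (hi t)) ->
  forall k n th h x, (n + k <= T)%N ->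
  (\sum_(j < k) ((mc (n + j).+1)%:E +
     delta%:E * level_expect w (pi th) (u (n + j).+1) j (n := n) h x) <=
   expected_cost I (pi th) k h x)%E.
Proof.
move=> d0 mc0 mu u01 Hc; have u0 t y : 0 <= u t y by case/andP: (u01 t y).
elim=> [|k IH] n th h x nkT; first by rewrite big_ord0.
have nkT' : (n.+1 + k <= T)%N by rewrite addSnnS.
have nT : (n < T)%N by rewrite (leq_trans _ nkT)// addnS ltnS leq_addr.
have njT (j : 'I_k) : (n.+1 + j < T)%N.
  by rewrite (leq_trans _ nkT')// -addnS leq_add2l.
rewrite expected_costS//.
pose L (j : nat) y := mix (w n.+1)
  (after_level (u (n.+1 + j).+1) j ((th, (h, x)), y) (lo n.+1))
  (after_level (u (n.+1 + j).+1) j ((th, (h, x)), y) (hi n.+1)).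
have L0 j y : (0 <= L j y)%E by apply: mix_ge0; rewrite ?level_expect_ge0.
have mL (j : 'I_k) : measurable_fun [set: R] (L j).
  exact: (@measurable_mix_after (u (n.+1 + j).+1) j n (th, (h, x))).
(* [g] is the lower bound conditioned on the first level [y], so that the comparison becomes
   pointwise under the integral over [y]. *)
pose g y := ((mc n.+1)%:E + delta%:E * (u n.+1 y)%:E +
  \sum_(j < k) ((mc (n.+1 + j).+1)%:E + delta%:E * L j y))%E.
have muE : measurable_fun [set: R] (fun y => (u n.+1 y)%:E).
  exact/measurable_EFinP.
have g1_ge0 y : (0 <= (mc n.+1)%:E + delta%:E * (u n.+1 y)%:E)%E.
  by apply: adde_ge0; last apply: mule_ge0; rewrite lee_fin.
have mg1 : measurable_fun [set: R]
    (fun y => ((mc n.+1)%:E + delta%:E * (u n.+1 y)%:E)%E).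
  by apply: emeasurable_funD => //; exact: measurable_funeM.
have g2_ge0 (j : 'I_k) y : (0 <= (mc (n.+1 + j).+1)%:E + delta%:E * L j y)%E.
  by apply: adde_ge0; last apply: mule_ge0; rewrite ?lee_fin.
have mg2 (j : 'I_k) : measurable_fun [set: R]
    (fun y => ((mc (n.+1 + j).+1)%:E + delta%:E * L j y)%E).
  by apply: emeasurable_funD => //; exact: measurable_funeM.
have intc (c : R) (f : R -> \bar R) : 0 <= c -> measurable_fun [set: R] f ->
    (forall y, 0 <= f y)%E ->
    (\int[pi th n h x]_y (c%:E + delta%:E * f y) =
      c%:E + delta%:E * \int[pi th n h x]_y f y)%E.
  move=> c0 mf f0; rewrite ge0_integralD//=; last 2 first.
  - by move=> y _; rewrite mule_ge0.
  - exact: measurable_funeM.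
  rewrite ge0_integralZl_EFin// integral_cst//; congr (_ + _)%E.
  by rewrite [X in (_ * X)%E](probability_setT (pi th n h x)) mule1.
have -> : (\sum_(j < k.+1) ((mc (n + j).+1)%:E +
    delta%:E * level_expect w (pi th) (u (n + j).+1) j h x) =
    \int[pi th n h x]_y g y)%E.
  rewrite ge0_integralD//=; last 2 first.
  - by move=> y _; apply: sume_ge0.
  - exact: emeasurable_sum.
  rewrite ge0_integral_sum//= intc//; last by move=> y; rewrite lee_fin.
  rewrite big_ord_recl/= addn0; congr (_ + _)%E.
  apply: eq_bigr => j _; rewrite intc//.
  by rewrite /bump leq0n add1n addnS addSn.
apply: ge0_le_integral => //=.
- by move=> y _; rewrite adde_ge0// sume_ge0.
- by apply: emeasurable_funD => //; exact: emeasurable_sum.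
- by apply: measurable_mix; exact: measurable_stage_section.
move=> y _.
(* [S d] is the induction hypothesis applied to the state reached after level [y] and demand [d]. *)
pose S d := (\sum_(j < k) ((mc (n.+1 + j).+1)%:E + delta%:E *
   after_level (u (n.+1 + j).+1) j ((th, (h, x)), y) d))%E.
apply: (@le_trans _ _ (mix (w n.+1)
    ((period_cost I n.+1 y (lo n.+1))%:E + S (lo n.+1))
    ((period_cost I n.+1 y (hi n.+1))%:E + S (hi n.+1)))); last first.
  by apply: le_mix => //; apply: leeD => //; exact: IH.
pose l j d := fine (after_level (u (n.+1 + j).+1) j ((th, (h, x)), y) d).
have lE (j : 'I_k) d :
    after_level (u (n.+1 + j).+1) j ((th, (h, x)), y) d = (l j d)%:E.
  by rewrite fineK// level_expect_fin_num.
have SE d : S d = (\sum_(j < k) (mc (n.+1 + j).+1 + delta * l j d))%:E.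
  by rewrite -sumEFin; apply: eq_bigr => j _; rewrite lE -EFinM -EFinD.
have gE : g y = (mc n.+1 + delta * u n.+1 y + \sum_(j < k)
    (mc (n.+1 + j).+1 + delta * (w n.+1 * l j (lo n.+1) +
       (1 - w n.+1) * l j (hi n.+1))))%:E.
  rewrite [RHS]EFinD -sumEFin /g; congr (_ + _)%E.
  by apply: eq_bigr => j _; rewrite /L !lE mixEFin -EFinM -EFinD.
rewrite gE !SE -!EFinD mixEFin lee_fin.
rewrite [leRHS](_ : _ = (w n.+1 * period_cost I n.+1 y (lo n.+1) +
  (1 - w n.+1) * period_cost I n.+1 y (hi n.+1)) + (w n.+1 *
  (\sum_(j < k) (mc (n.+1 + j).+1 + delta * l j (lo n.+1))) + (1 - w n.+1) *
  (\sum_(j < k) (mc (n.+1 + j).+1 + delta * l j (hi n.+1))))); last by ring.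
apply: lerD; first exact: Hc.
rewrite !mulr_sumr -big_split/= le_eqVlt; apply/orP; left; apply/eqP.
by apply: eq_bigr => j _; ring.
Qed.

(** If neither demand ever leaves more stock than the next target, each target is reached exactly
    and the one-period costs add up. *)
Lemma expected_cost_base_stock_le (mc m : nat -> R) :
  (forall n th h x,
    pi th n h x = dirac (Num.max x (m n.+1)) :> probability R R) ->
  (forall t, (1 <= t <= T)%N ->
    w t * period_cost I t (m t) (lo t) +
    (1 - w t) * period_cost I t (m t) (hi t) <= mc t) ->
  (forall t, Num.max (m t - lo t) 0 <= m t.+1) ->
  (forall t, Num.max (m t - hi t) 0 <= m t.+1) ->
  forall k n th h x, (n + k <= T)%N -> x <= m n.+1 ->
  (expected_cost I (pi th) k (n := n) h x <= \sum_(j < k) (mc (n + j).+1)%:E)%E.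
Proof.
move=> piE Hc mlo mhi; elim=> [|k IH] n th h x nkT xm.
  by rewrite big_ord0.
have nkT' : (n.+1 + k <= T)%N by rewrite addSnnS.
have nT : (n < T)%N by rewrite (leq_trans _ nkT)// addnS ltnS leq_addr.
rewrite expected_costS// piE (max_idPr xm) integral_dirac//=; last first.
  by apply: measurable_mix; exact: measurable_stage_section.
rewrite diracT mul1e.
pose S := (\sum_(j < k) mc (n.+1 + j).+1)%R.
apply: (@le_trans _ _ (mix (w n.+1)
    ((period_cost I n.+1 (m n.+1) (lo n.+1))%:E + S%:E)
    ((period_cost I n.+1 (m n.+1) (hi n.+1))%:E + S%:E))).
  apply: le_mix => //; apply: leeD => //; rewrite -sumEFin; apply: IH => //.
    exact: mlo.
  exact: mhi.
rewrite -!EFinD mixEFin sumEFin lee_fin big_ord_recl addn0.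
have -> : \sum_(j < k) mc (n + lift ord0 j).+1 = S.
  by apply: eq_bigr => j _; rewrite /= /bump leq0n add1n addnS addSn.
by have := Hc n.+1; rewrite /= nT => /(_ isT); lra.
Qed.

End dynamics.

Section base_stock.
Context {R : realType}.

(** Measurability into the space of probabilities is tested on evaluations at measurable sets, where
    it is that of the Dirac kernel. *)
Lemma measurable_dirac_comp d (X : measurableType d) (f : X -> R) :
  measurable_fun [set: X] f ->
  measurable_fun [set: X] (fun x => dirac (f x) : pprobability R R).
Proof.
move=> mf.
apply: (measurability (@pset _ _ _ : set (set (pprobability R R)))) => //.
move=> _ -[_ [r r01] [U mU <-]] <-.
apply: emeasurable_fun_infty_o => //.
exact: (measurable_kernel (kdirac mf) U mU).
Qed.

Definition base_stock (m : nat -> R) : policy R :=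
  fun n _ x => dirac (Num.max x (m n.+1)).

Lemma measurable_base_stock (m : nat -> R) (n : nat) :
  measurable_fun [set: n.-tuple (observation R) * R]
    (fun p => base_stock m p.1 p.2 : pprobability R R).
Proof.
by apply: measurable_dirac_comp; apply: measurable_maxr.
Qed.

Lemma feasible_base_stock (T : nat) (m : nat -> R) :
  feasible R T (base_stock m).
Proof.
move=> n nT; split; first exact: measurable_base_stock.
move=> h x x0; rewrite /base_stock/= diracE mem_set//=.
by rewrite in_itv/= andbT le_max lexx.
Qed.
End base_stock.

(** * Hard instances *)

Section hard_instances.
Context {R : realType} (T : nat) (delta : R).
Hypothesis delta01 : 0 <= delta <= 1 / 16.

(* In the odd period [i.*2.+1], the likelier of the demands 1/4 and 3/4, which
   is also the optimal level, is selected by [s i].  The demand of an even period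
   is 5/8 or 1: since 5/8 is both its median and its least value, the median
   levels are always reachable and the myopic policy is optimal. *)
Definition low_prob (s : nat -> bool) (t : nat) : R :=
  if odd t then (if s t./2 then 1 / 2 + delta else 1 / 2 - delta) else 3 / 4.
Definition low_demand (t : nat) : R := if odd t then 1 / 4 else 5 / 8.
Definition high_demand (t : nat) : R := if odd t then 3 / 4 else 1.
Definition median (s : nat -> bool) (t : nat) : R :=
  if odd t then (if s t./2 then 1 / 4 else 3 / 4) else 5 / 8.
(** The cost of [median], the same for all signs: a gap 1/2 with probability [1/2 - delta] in odd
    periods, a gap 3/8 with probability 1/4 in even ones. *)
Definition min_cost (t : nat) : R :=
  if odd t then (1 / 2 - delta) / 2 else 3 / 32.

(** Position of the level between the candidates 1/4 and 3/4, rescaled to run from 0 to 1 and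
    clamped beyond them. *)
Definition excess (y : R) : R :=
  2 * Num.max (1 / 4) (Num.min y (3 / 4)) - 1 / 2.
Definition loss (s : nat -> bool) (t : nat) (y : R) : R :=
  if odd t then (if s t./2 then excess y else 1 - excess y) else 0.

Lemma low_prob01 s t : 0 <= low_prob s t <= 1.
Proof.
case/andP: delta01 => d0 d1; rewrite /low_prob.
by case: (odd t); first case: (s _); apply/andP; split; lra.
Qed.

Lemma excess01 y : 0 <= excess y <= 1.
Proof.
rewrite /excess; set c := Num.max _ _.
have c1 : 1 / 4 <= c by rewrite le_max lexx.
have c2 : c <= 3 / 4 by rewrite ge_max ge_min lexx orbT andbT; lra.
by apply/andP; split; lra.
Qed.

Lemma loss01 s t y : 0 <= loss s t y <= 1.
Proof.
have /andP[v0 v1] := excess01 y; rewrite /loss.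
by case: (odd t); first case: (s _); apply/andP; split; lra.
Qed.

Lemma measurable_loss s t : measurable_fun [set: R] (loss s t).
Proof.
have mv : measurable_fun [set: R] excess.
  apply: measurable_funB => //; apply: measurable_funM => //.
  by apply: measurable_maxr => //; apply: measurable_minr.
rewrite /loss; case: (odd t) => //; case: (s _) => //.
exact: measurable_funB.
Qed.

Definition hard_instance (s : nat -> bool) : lost_sales R T.
Proof.
refine (@LostSales R T
  (fun t => two_point (low_prob s t) (low_demand t) (high_demand t))
  (fun=> 1) (fun=> 1) 1 _ _ _) => [t _|t _|t _]; rewrite ?ltr01//.
rewrite two_pointE ?low_prob01// !diracE.
rewrite !mem_set/= ?in_itv/=; last 2 first.
  by rewrite /high_demand; case: (odd t); apply/andP; split; lra.
  by rewrite /low_demand; case: (odd t); apply/andP; split; lra.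
by rewrite !mule1 -EFinD addrC subrK.
Defined.

Lemma hard_period_cost s t y d :
  period_cost (hard_instance s) t y d = `|y - d|.
Proof.
rewrite /period_cost /= !mul1r; case: (lerP y d) => yd.
  by rewrite max_r ?subr_le0// max_l ?subr_ge0// add0r.
by rewrite max_l ?subr_ge0 ?ltW// max_r ?subr_le0 ?ltW// addr0.
Qed.

Lemma median_cost s t :
  low_prob s t * `|median s t - low_demand t| +
  (1 - low_prob s t) * `|median s t - high_demand t| = min_cost t.
Proof.
rewrite /low_prob /median /low_demand /high_demand /min_cost.
case: (odd t); first case: (s _).
- by rewrite subrr normr0 distrC ger0_norm; lra.
- by rewrite subrr normr0 ger0_norm; lra.
- by rewrite subrr normr0 distrC ger0_norm; lra.
Qed.

(** In an odd period the expected cost is affine of slope [2 * delta] or [- 2 * delta] between the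
    candidates, which are 1/2 apart; this is an equality there. Outside, the loss is constant while
    the cost does not decrease away from the interval. *)
Lemma loss_cost s t y :
  min_cost t + delta * loss s t y <= low_prob s t * `|y - low_demand t| +
    (1 - low_prob s t) * `|y - high_demand t|.
Proof.
case/andP: delta01 => d0 d1.
rewrite /low_prob /low_demand /high_demand /min_cost /loss /excess.
case: (odd t); last first.
  rewrite mulr0 addr0.
  by case: (lerP y (5 / 8)) => h1; case: (lerP y 1) => h2; lra.
have h : 1 / 4 <= 3 / 4 :> R by lra.
by case: (lerP y (3 / 4)) => h2; case: (lerP y (1 / 4)) => h1;
  rewrite ?(max_r h); case: (s _); lra.
Qed.

Definition optimum : R := \sum_(j < T) min_cost j.+1.

Lemma min_cost_ge0 t : 0 <= min_cost t.
Proof.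
by case/andP: delta01 => d0 d1; rewrite /min_cost; case: (odd t); lra.
Qed.

(** The base-stock policy at the medians achieves this: an odd period leaves at most [1/2 <= 5/8] in
    stock, and an even one leaves nothing. *)
Lemma optimal_value_le s :
  (optimal_value (hard_instance s) 0 <= optimum%:E)%E.
Proof.
apply: (@le_trans _ _ (value (hard_instance s) (base_stock (median s)) 0)).
  by apply: ereal_inf_lbound; exists (base_stock (median s)) => //;
    exact: feasible_base_stock.
rewrite /value /optimum -sumEFin.
apply: (@expected_cost_base_stock_le R T _ unit (fun=> base_stock (median s))
  _ (low_prob s) low_demand high_demand (low_prob01 s) (hard_instance s) _
  min_cost (median s) _ _ _ _ T 0%N tt) => //.
- move=> n nT; apply: measurable_dirac_comp; apply: measurable_maxr => //.
  exact: (measurableT_comp measurable_snd measurable_snd).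
- by move=> t tT; rewrite !hard_period_cost median_cost.
- move=> t; rewrite /median /low_demand /=; case: (odd t) => /=;
    by case: ifP => _; rewrite ge_max; apply/andP; split; lra.
- move=> t; rewrite /median /high_demand /=; case: (odd t) => /=;
    by case: ifP => _; rewrite ge_max; apply/andP; split; lra.
- by rewrite /median /=; case: ifP => _; lra.
Qed.

Lemma optimal_value_ge0 s : (0 <= optimal_value (hard_instance s) 0)%E.
Proof.
by apply: le_ereal_inf_tmp => _ [rho _ <-]; exact: expected_cost_ge0.
Qed.

Lemma eps_optimal_loss_le d (Th : measurableType d) (pi : Th -> policy R)
    (s : nat -> bool) (eps : R) (th : Th) :
  (forall n, (n < T)%N ->
    measurable_fun [set: Th * (n.-tuple (observation R) * R)]
      (fun p => pi p.1 n p.2.1 p.2.2 : pprobability R R)) ->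
  eps_optimal (hard_instance s) eps (pi th) ->
  (\sum_(j < T) delta%:E * level_expect low_demand high_demand (low_prob s)
     (pi th) (loss s j.+1) j [tuple] 0 <= eps%:E)%E.
Proof.
move=> mpi [_ opt]; case/andP: (delta01) => d0 d1.
(* Finiteness is what allows moving the optimal value across the extended-real inequality. *)
have vfin : optimal_value (hard_instance s) 0 \is a fin_num.
  rewrite ge0_fin_numE ?optimal_value_ge0//.
  by rewrite (le_lt_trans (optimal_value_le s))// ltry.
have vle : (value (hard_instance s) (pi th) 0 <= optimum%:E + eps%:E)%E.
  move: opt; rewrite leeBlDr// => /le_trans; apply.
  by rewrite addeC leeD2r// optimal_value_le.
have := @le_expected_cost R T _ Th pi mpi (low_prob s) low_demand high_demand
  (low_prob01 s) (hard_instance s) (fun=> erefl) delta min_cost (loss s) d0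
  min_cost_ge0 (measurable_loss s) (loss01 s) _ T 0%N th [tuple] 0 (leqnn _).
rewrite big_split/= sumEFin => /(_ _)/le_trans => /(_ _ _ vle).
rewrite leeD2lE//; apply => t y tT.
by rewrite !hard_period_cost loss_cost.
Qed.

End hard_instances.

(** Serves to drop the even periods: the odd period [i.*2.+1] has zero-based index [i.*2]. *)
Lemma sum_double_le (R : realType) (K : nat) (f : nat -> R) :
  (forall j, 0 <= f j) -> \sum_(i < K) f i.*2 <= \sum_(j < 2 * K) f j.
Proof.
move=> f0; elim: K => [|K IH]; first by rewrite muln0 !big_ord0.
rewrite mulnS big_ord_recr/= (_ : (2 + 2 * K)%N = (2 * K).+2)// !big_ord_recr/=.
by rewrite -addrA lerD// -mul2n lerDl.
Qed.

(** * Mistakes of a policy in the odd periods *)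

Section mistake.
Context {R : realType} (K : nat) (delta : R).
Hypothesis delta01 : 0 <= delta <= 1 / 16.
Context d (Th : measurableType d) (pi : Th -> policy R).
Arguments pi : clear implicits.
Hypothesis mpi : forall n, (n < 2 * K)%N ->
  measurable_fun [set: Th * (n.-tuple (observation R) * R)]
    (fun p => pi p.1 n p.2.1 p.2.2 : pprobability R R).

(* In units of the cost gap [delta] between the two candidate levels of period
   [i.*2.+1], the expected loss of the policy [pi th] in that period. *)
Definition mistake (s : nat -> bool) (i : nat) (th : Th) : R :=
  fine (level_expect low_demand high_demand (low_prob delta s) (pi th)
    (loss s i.*2.+1) i.*2 [tuple] 0).

Let level (s : nat -> bool) (j : nat) (th : Th) : \bar R :=
  level_expect low_demand high_demand (low_prob delta s) (pi th)
    (loss s j.+1) j [tuple] 0.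

Let level_fin_num s j th : (j < 2 * K)%N -> level s j th \is a fin_num.
Proof.
move=> jT; apply: (@level_expect_fin_num R (2 * K)) => //.
- exact: low_prob01.
- exact: measurable_loss.
- exact: loss01.
Qed.

Let level_ge0 s j th : (0 <= level s j th)%E.
Proof.
apply: level_expect_ge0 => [|y]; first exact: low_prob01.
by case/andP: (loss01 s j.+1 y).
Qed.

Lemma mistake_ge0 s i th : 0 <= mistake s i th.
Proof. exact/fine_ge0/level_ge0. Qed.

(** The level of period [i.*2.+1] depends only on demands of earlier periods, whose laws agree under
    [s] and [s']; only the loss changes, into its complement. *)
Lemma mistake_flip s s' i th :
  (i < K)%N -> (forall j, (j < i)%N -> s j = s' j) -> s' i = ~~ s i ->
  mistake s' i th = 1 - mistake s i th.
Proof.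
move=> iK ss' s'i.
have iT : (0 + i.*2 < 2 * K)%N by rewrite add0n -mul2n ltn_pmul2l.
have E : level_expect low_demand high_demand (low_prob delta s') (pi th)
    (loss s' i.*2.+1) i.*2 [tuple] 0 =
  level_expect low_demand high_demand (low_prob delta s) (pi th)
    (fun y => 1 - loss s i.*2.+1 y) i.*2 [tuple] 0.
  have -> : loss s' i.*2.+1 = (fun y : R => 1 - loss s i.*2.+1 y).
    apply/funext => y; rewrite /loss /= odd_double uphalf_double s'i.
    by case: (s i) => //=; rewrite subKr.
  apply: eq_level_expect => t; rewrite add0n => /andP[_ ti]; rewrite /low_prob.
  case: ifPn => // ot; rewrite ss'//.
  (* An odd period [t <= i.*2] reads the sign at [t./2], which is smaller than [i]. *)
  have : (t./2.*2.+1 <= i.*2)%N by move: ti; rewrite -{1}(odd_double_half t) ot.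
  by rewrite ltn_double.
have := @level_expect_compl R (2 * K) _ Th pi mpi (low_prob delta s)
  low_demand high_demand (low_prob01 delta01 s) (loss s i.*2.+1) i.*2 0 th
  [tuple] 0 (measurable_loss s _) (loss01 s _) iT.
rewrite -E -[X in (X + _)%E]fineK; last by apply: level_fin_num.
rewrite -[X in (_ + X)%E]fineK; last by apply: level_fin_num.
by rewrite -/(mistake s i th) -/(mistake s' i th) => -[<-]; ring.
Qed.

Lemma eps_optimal_mistakes_le s eps th :
  eps_optimal (hard_instance (2 * K) delta01 s) eps (pi th) ->
  delta * \sum_(i < K) mistake s i th <= eps.
Proof.
move=> opt; have /= := eps_optimal_loss_le mpi opt.
have E (j : 'I_(2 * K)) : (delta%:E * level s j th)%E =
    (delta * fine (level s j th))%:E by rewrite EFinM fineK// level_fin_num.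
rewrite (eq_bigr _ (fun j _ => E j)) sumEFin lee_fin; apply: le_trans.
rewrite -mulr_sumr ler_wpM2l//; first by case/andP: delta01.
apply: (sum_double_le K (f := fun j => fine (level s j th))) => j.
exact/fine_ge0/level_ge0.
Qed.
End mistake.

(** * Censored logs *)

Section logs.
Context {R : realType}.

(** Applied to censoring: truncating each coordinate moves its two atoms and keeps their
    probabilities. *)
Lemma expect_map (n : nat) (p a b : 'I_n -> R) (c : 'I_n -> R -> R)
    (f : n.-tuple R -> R) :
  expect p a b (fun z => f [tuple c k (tnth z k) | k < n]) =
  expect p (fun k => c k (a k)) (fun k => c k (b k)) f.
Proof.
elim: n p a b c f => [|n IH] p a b c f /=.
  by congr f; apply: eq_from_tnth => -[].
have E x : expect (fun i => p (lift ord0 i)) (fun i => a (lift ord0 i))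
    (fun i => b (lift ord0 i))
    (fun z => f [tuple c k (tnth [tuple of x :: z] k) | k < n.+1]) =
  expect (fun i => p (lift ord0 i)) (fun i => c (lift ord0 i) (a (lift ord0 i)))
    (fun i => c (lift ord0 i) (b (lift ord0 i)))
    (fun z => f [tuple of c ord0 x :: z]).
  rewrite -[RHS](IH _ _ _ (fun k => c (lift ord0 k))
    (fun z => f [tuple of c ord0 x :: z])).
  apply: eq_expect => z; congr f; apply: eq_from_tnth => k.
  rewrite tnth_mktuple; case: (unliftP ord0 k) => [k' ->|->//].
  by rewrite !tnthS tnth_mktuple.
by rewrite !E.
Qed.

Context {T : nat} (N : nat -> nat) (b : boundaries R N).
Arguments b : clear implicits.

Definition log_period (k : 'I_#|slot T N|) : nat := (tag (enum_val k)).+1.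
Definition log_boundary (k : 'I_#|slot T N|) : R :=
  b (tag (enum_val k)).+1 (tagged (enum_val k)).

Lemma measurable_censor : measurable_fun [set: logs R T N] (censor b).
Proof.
apply/measurable_fun_tnthP => k.
rewrite (_ : _ \o _ = fun z => Num.min (tnth z k) (log_boundary k)); last first.
  by apply/funext => z /=; rewrite tnth_mktuple.
by apply: measurable_minr => //; exact: measurable_tnth.
Qed.

Variables (I : lost_sales R T) (w lo hi : nat -> R).
Hypothesis w01 : forall t, 0 <= w t <= 1.
Hypothesis demandI : demand_law I = fun t => two_point (w t) (lo t) (hi t).

Definition expect_logs (f : logs R T N -> R) : R :=
  expect (fun k => w (log_period k))
    (fun k => Num.min (lo (log_period k)) (log_boundary k))
    (fun k => Num.min (hi (log_period k)) (log_boundary k)) f.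

Lemma integral_latent_law (f : logs R T N -> R) :
  measurable_fun [set: logs R T N] f -> (forall z, 0 <= f z) ->
  (\int[latent_law I N]_z (f (censor b z))%:E = (expect_logs f)%:E)%E.
Proof.
move=> mf f0; rewrite /latent_law demandI.
rewrite (@integral_product_two_point _ _
  (fun k => w (log_period k)) (fun k => lo (log_period k))
  (fun k => hi (log_period k)) (fun z => f (censor b z)))//; last first.
  exact: (measurableT_comp mf measurable_censor).
congr EFin; exact: (expect_map _ _ _ (fun k x => Num.min x (log_boundary k))).
Qed.

(** Tonelli with the seed outermost, so that the testing bound can be used at each fixed seed. *)
Lemma probability_censored d (W : measurableType d) (Q : probability W R)
    (E : set (logs R T N * W)) : measurable E ->
  ((latent_law I N \x Q) [set p | E (censor b p.1, p.2)] =
   \int[Q]_v (expect_logs (fun z => \1_E (z, v)))%:E)%E.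
Proof.
move=> mE; pose E' := [set p | E (censor b p.1, p.2)].
have mE' : measurable E'.
  rewrite -[E']setTI.
  apply: (measurable_fun_pair
    (f := fun p : logs R T N * W => censor b p.1) (g := snd)) => //.
  exact: (measurableT_comp measurable_censor measurable_fst).
transitivity (\int[(latent_law I N \x Q)]_p (\1_E' p)%:E)%E.
  by rewrite integral_indic// setIT.
have mind (A : set (logs R T N * W)) : measurable A ->
    measurable_fun [set: logs R T N * W] (fun p => (\1_A p)%:E : \bar R).
  by move=> mA; apply/measurable_EFinP; exact: measurable_indic.
rewrite fubini_tonelli2//=; last exact: mind.
apply: eq_integral => v _; rewrite /fubini_G -integral_latent_law//.
apply: (measurableT_comp (g := fun z => (z, v)) (measurable_indic mE)).
exact: pair2_measurable.
Qed.
End logs.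

(** * Averaging over the signs *)

Section averaging.
Context {R : realType} (K : nat) (delta : R).
Hypothesis delta01 : 0 <= delta <= 1 / 16.
Context (N : nat -> nat) (b : boundaries R N).
Arguments b : clear implicits.
Hypothesis blind : forall i, (i < K)%N -> forall j,
  b i.*2.+1 j <> 7 / 8 -> b i.*2.+1 j < 1 / 4.

Definition covered (t : nat) : nat := #|[pred j : 'I_(N t) | b t j == 7 / 8]|.

(** Extends a sign vector by [false]; finite vectors make the average over signs a finite sum. *)
Definition sign (s : {ffun 'I_K -> bool}) (j : nat) : bool :=
  if insub j is Some i then s i else false.

Definition flip (i : 'I_K) (s : {ffun 'I_K -> bool}) : {ffun 'I_K -> bool} :=
  [ffun j => if j == i then ~~ s j else s j].

Lemma flipK i : involutive (flip i).
Proof.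
by move=> s; apply/ffunP => j; rewrite !ffunE; case: eqP; rewrite ?negbK.
Qed.

Lemma sign_flip i s j :
  sign (flip i s) j = if j == i then ~~ sign s j else sign s j.
Proof.
rewrite /sign; case: insubP => [k jK kj|jK].
  by rewrite ffunE -val_eqE /= kj.
by case: eqP => // ji; rewrite ji ltn_ord in jK.
Qed.

Let expect_s (s : {ffun 'I_K -> bool}) (f : logs R (2 * K) N -> R) : R :=
  expect_logs b (low_prob delta (sign s)) low_demand high_demand f.

(** The flattened sum over slots is reindexed by period and log; only the period [i.*2.+1]
    survives. *)
Lemma sum_covered (i : 'I_K) (c : R) :
  \sum_(k < #|slot (2 * K) N|)
    (if (log_period k == i.*2.+1) && (log_boundary b k == 7 / 8)
     then c else 0) =
  c * (covered i.*2.+1)%:R.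
Proof.
have iT : (i.*2 < 2 * K)%N by rewrite -mul2n ltn_pmul2l.
rewrite -(@big_enum_val _ _ _ _ predT (fun x : slot (2 * K) N =>
  if ((tag x).+1 == i.*2.+1) && (b (tag x).+1 (tagged x) == 7 / 8)
  then c else 0)) /=.
rewrite -(@sig_big_dep _ _ _ _ (fun t : 'I_(2 * K) => 'I_(N t.+1)) xpredT
  (fun _ _ => true) (fun t j => if (t.+1 == i.*2.+1) && (b t.+1 j == 7 / 8)
  then c else 0)) /=.
rewrite (bigD1 (Ordinal iT))//= [X in _ + X]big1 ?addr0; last first.
  move=> t ti; apply: big1 => j _; rewrite eqSS.
  by rewrite (negbTE (_ : (t : nat) != i.*2)).
rewrite eqxx/= -big_mkcond/= sumr_const mulr_natr.
by [].
Qed.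

(** Flipping sign [i] affects only logs of period [i.*2.+1], and is visible only at boundary 7/8.
    Each such log lowers the squared affinity factor to [1 - 4 delta^2]; the factor 3 of
    [expect_testing] turns 4 into 12. *)
Lemma expect_testing_logs (i : 'I_K) s phi : (forall z, 0 <= phi z <= 1) ->
  3 / 4 - 12 * delta ^+ 2 * (covered i.*2.+1)%:R <=
  expect_s s phi + expect_s (flip i s) (fun z => 1 - phi z).
Proof.
move=> phi01; case/andP: (delta01) => d0 d1.
pose p := low_prob delta (sign s) i.*2.+1.
pose beta (k : 'I_#|slot (2 * K) N|) : R :=
  if (log_period k == i.*2.+1) && (log_boundary b k == 7 / 8)
  then 4 * p * (1 - p) else 1.
have betaE : 4 * p * (1 - p) = 1 - 4 * delta ^+ 2.
  rewrite /p /low_prob /= odd_double uphalf_double.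
  by case: (sign s i) => /=; field.
have -> : 12 * delta ^+ 2 * (covered i.*2.+1)%:R = 3 * \sum_k (1 - beta k).
  rewrite (_ : 12 * delta ^+ 2 = 3 * (4 * delta ^+ 2)); last by ring.
  rewrite -mulrA -sum_covered; congr (_ * _); apply: eq_bigr => k _.
  by rewrite /beta; case: ifP => _; rewrite ?betaE; ring.
apply: expect_testing => //.
- by move=> k; exact: low_prob01.
- move=> k; rewrite /beta betaE; case: ifP => _; last by rewrite ler01 lexx.
  by apply/andP; split; nra.
- move=> k; rewrite /beta; case: (eqVneq (log_period k) i.*2.+1) => kE /=.
    case: eqP => bE.
      apply: Or32; rewrite kE /p; split => //.
      rewrite /low_prob /= odd_double uphalf_double sign_flip eqxx.
      by case: (sign s i) => /=; lra.
    apply: Or33; split => //; last exact: low_prob01.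
    (* both demands exceed the boundary, which is all that gets recorded *)
    have bl t (j : 'I_(N t)) : t = i.*2.+1 -> b t j <> 7 / 8 -> b t j < 1 / 4.
      by move=> tE; move: j; rewrite tE => j; exact: blind.
    have lt : log_boundary b k < 1 / 4 by exact: bl.
    rewrite kE /low_demand /high_demand /= odd_double /=.
    by rewrite !min_r//; lra.
  (* In every other period the law is unchanged: an even one ignores the signs, and another odd one
     reads a different sign. *)
  apply: Or31; split => //; rewrite /low_prob; case: ifP => // ot.
  have ji : (log_period k)./2 != i :> nat.
    apply: contraNN kE => /eqP <-.
    by rewrite -{1}(odd_double_half (log_period k)) ot.
  by rewrite sign_flip (negbTE ji).
Qed.
Context d (W : measurableType d) (Q : probability W R).
Variable A : algorithm R (2 * K) N W.
Hypothesis mA : measurable_algorithm A.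

Let pi (p : logs R (2 * K) N * W) : policy R := A p.1 p.2.

Let mis (s : {ffun 'I_K -> bool}) (i : 'I_K) (z : logs R (2 * K) N) (v : W) :
    R :=
  mistake delta pi (sign s) i (z, v).

Let mis_flip s i z v : mis (flip i s) i z v = 1 - mis s i z v.
Proof.
apply: (mistake_flip delta01 mA) => // [j ji|].
  by rewrite sign_flip (ltn_eqF ji).
by rewrite sign_flip eqxx.
Qed.

(** The upper bound is the nonnegativity of the mistake under the flipped sign. *)
Let mis01 s i z v : 0 <= mis s i z v <= 1.
Proof.
by rewrite mistake_ge0//= -subr_ge0 -mis_flip mistake_ge0.
Qed.

(** The flip at [i] permutes the sign vectors, so pairing each vector with its flip counts every
    term twice; hence the factor 1/2. *)
Lemma sum_mistakes_ge v :
  #|{ffun 'I_K -> bool}|%:R / 2 *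
    \sum_(i < K) (3 / 4 - 12 * delta ^+ 2 * (covered i.*2.+1)%:R) <=
  \sum_s expect_s s (fun z => \sum_(i < K) mis s i z v).
Proof.
under [leRHS]eq_bigr => s _ do rewrite /expect_s /expect_logs expect_sum.
rewrite exchange_big/= mulr_sumr; apply: ler_sum => i _.
set c := 3 / 4 - _; pose x s := expect_s s (mis s i ^~ v).
rewrite -[leRHS]/(\sum_s x s).
have : \sum_(s : {ffun 'I_K -> bool}) c <= \sum_s (x s + x (flip i s)).
  apply: ler_sum => s _.
  have := @expect_testing_logs i s (mis s i ^~ v) (fun z => mis01 s i z v).
  move=> /le_trans; apply; rewrite lerD2l le_eqVlt; apply/orP; left; apply/eqP.
  by apply: eq_expect => z; rewrite mis_flip.
rewrite [X in _ <= X -> _]big_split/=.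
have <- : \sum_s x s = \sum_s x (flip i s).
  exact: (reindex_inj (inv_inj (flipK i))).
rewrite sumr_const -mulr_natl; lra.
Qed.

Lemma succeeds_sum_covered_ge (eps : R) : 0 < delta -> (0 < K)%N ->
  16 * eps = delta * K%:R ->
  (forall s, succeeds b Q A eps (3 / 4)
     (hard_instance (2 * K) delta01 (sign s))) ->
  K%:R <= 96 * delta ^+ 2 * \sum_(i < K) (covered i.*2.+1)%:R.
Proof.
move=> d0 K0 epsE succ.
have k0 : 0 < K%:R :> R by rewrite ltr0n.
have {succ} /choice[E HE] : forall s, exists E : set (logs R (2 * K) N * W),
  [/\ measurable E, E `<=` [set p | eps_optimal
     (hard_instance (2 * K) delta01 (sign s)) eps (A p.1 p.2)] &
    ((3 / 4)%:E <= \int[Q]_v (expect_s s (fun z => \1_E (z, v)))%:E)%E].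
  move=> s; have [E [mE EA] PE] := succ s; exists E; split => //.
  by rewrite -(@probability_censored _ _ _ b
    (hard_instance (2 * K) delta01 (sign s)) _ _ _
    (low_prob01 delta01 (sign s)) erefl).
pose Y s v := expect_s s (fun z => \1_(E s) (z, v)).
have Y0 s v : 0 <= Y s v.
  by apply: expect_ge0 => [k|z]; [exact: low_prob01|rewrite indicE].
have mY s : measurable_fun [set: W] (Y s).
  apply: measurable_expect => z; have [mE _ _] := HE s.
  apply: (measurableT_comp (g := fun v => (z, v)) (measurable_indic mE)).
  exact: pair1_measurable.
pose B : R := #|{ffun 'I_K -> bool}|%:R.
have B0 : 0 < B by rewrite ltr0n; apply/card_gt0P; exists [ffun=> false].
pose S : R := \sum_(i < K) (covered i.*2.+1)%:R.
(* Bounds the total success probability over all signs at a fixed seed. The constant is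
   [17/16 - 3/8], where 3/8 is half of the 3/4 in the testing bound. *)
pose C : R := B * (11 / 16 + 6 * delta ^+ 2 * S / K%:R).
have YC v : \sum_s Y s v <= C.
  (* The total mistake is at most [eps / delta = K/16] on success and at most [K] always, so adding
     [K] times the success indicator gives at most [17/16 * K]. *)
  have XY s : expect_s s (fun z => \sum_(i < K) mis s i z v) + K%:R * Y s v <=
      17 / 16 * K%:R.
    have <- : expect_s s (fun=> 17 / 16 * K%:R) = 17 / 16 * K%:R.
      exact: expect_cst.
    rewrite /Y /expect_s /expect_logs -expectZ -expectD.
    apply: le_expect => [k|z]; first exact: low_prob01.
    rewrite indicE; case: (boolP ((z, v) \in E s)) => [|_].
      rewrite inE => Ezv; have [_ EA _] := HE s.
      have := @eps_optimal_mistakes_le R K delta delta01 _ _ pi mA (sign s) eps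
        (z, v) (EA _ Ezv).
      rewrite mulr1 -/(mis s _ z v) => le_eps.
      have : delta * (\sum_(i < K) mis s i z v) <= delta * (K%:R / 16).
        by rewrite mulrA -epsE; move: le_eps; lra.
      by rewrite ler_pM2l//; lra.
    rewrite mulr0 addr0 (@le_trans _ _ (\sum_(i < K) 1))//.
      by apply: ler_sum => i _; case/andP: (mis01 s i z v).
    by rewrite sumr_const card_ord; lra.
  have hS : \sum_(i < K) (3 / 4 - 12 * delta ^+ 2 * (covered i.*2.+1)%:R) =
      K%:R * (3 / 4) - 12 * delta ^+ 2 * S.
    by rewrite sumrB sumr_const card_ord -[_ *+ _]mulr_natl -mulr_sumr.
  have hB (c : R) : \sum_(s : {ffun 'I_K -> bool}) c = B * c.
    by rewrite sumr_const -[_ *+ _]mulr_natl.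
  have h := sum_mistakes_ge v; rewrite -/B hS in h.
  have : \sum_s
      (expect_s s (fun z => \sum_(i < K) mis s i z v) + K%:R * Y s v) <=
      \sum_(s : {ffun 'I_K -> bool}) 17 / 16 * K%:R by apply: ler_sum.
  rewrite hB big_split/= -[X in _ + X]mulr_sumr => h'.
  rewrite -(ler_pM2l k0) /C.
  have -> : K%:R * (B * (11 / 16 + 6 * delta ^+ 2 * S / K%:R)) =
     B * (11 / 16 * K%:R + 6 * delta ^+ 2 * S) by field; rewrite gt_eqF.
  lra.
have : ((B * (3 / 4))%:E <= C%:E)%E.
  apply: (@le_trans _ _ (\sum_s \int[Q]_v (Y s v)%:E)%E).
    rewrite /B mulr_natl -sumr_const -sumEFin.
    by apply: lee_sum => s _; have [] := HE s.
  rewrite -ge0_integral_sum//=; last 2 first.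
  - by move=> s; exact/measurable_EFinP.
  - by move=> s v _; rewrite lee_fin.
  apply: (@le_trans _ _ (\int[Q]_v C%:E)%E); last first.
    by rewrite integral_cst// [X in (_ * X)%E](probability_setT Q) mule1.
  apply: ge0_le_integral => //=.
  - by move=> v _; apply: sume_ge0 => s _; rewrite lee_fin.
  - by apply: emeasurable_sum => s; exact/measurable_EFinP.
  - by move=> v _; rewrite sumEFin lee_fin.
rewrite lee_fin /C ler_pM2l// -/S => h.
(* The success level [3/4 = 12/16] exceeds 11/16 by 1/16, which the information term must supply. *)
have : 1 / 16 * K%:R <= 6 * delta ^+ 2 * S.
  rewrite -ler_pdivlMr//; lra.
lra.
Qed.

End averaging.

(** * The family, the boundaries and the constant *)

Lemma card_ord_lt (n m : nat) :
  (m <= n)%N -> #|[pred j : 'I_n | (j < m)%N]| = m.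
Proof.
move=> mn; rewrite -sum1_card -(big_ord_widen n (fun=> 1%N) mn).
by rewrite sum1_card card_ord.
Qed.

Theorem theorem2 (R : realType) :
  exists2 ccov : R, 0 < ccov &
  forall (T K : nat) (r eps : R),
    T = (2 * K)%N -> (4 <= T)%N -> 0 < r <= 1 -> 0 < eps <= T%:R / 512 ->
  exists F : set (lost_sales R T),
    (* (i) *)
    (forall I, F I -> forall t, (1 <= t <= T)%N ->
      ((1 / 2)%:E < demand_law I t `]-oo, (7 / 8)%R[%classic)%E /\
      (~~ odd t -> (0 < demand_law I t `](7 / 8)%R, +oo[%classic)%E)) /\
    (* unit costs *)
    (forall I, F I -> forall t, (1 <= t <= T)%N ->
      holding I t = 1 /\ shortage I t = 1) /\
    forall N : nat -> nat,
      (forall t, (1 <= t <= T)%N -> odd t ->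
        exists m : nat, r * (N t)%:R = m%:R) ->
    exists b : boundaries R N,
      (forall t, (1 <= t <= T)%N -> forall j, 0 <= b t j) /\
      (* (ii) *)
      (forall t, (1 <= t <= T)%N ->
        if odd t then
          #|[pred j : 'I_(N t) | b t j == 7 / 8]|%:R = r * (N t)%:R /\
          (forall j, b t j <> 7 / 8 -> b t j < 1 / 4)
        else forall j, b t j = 7 / 8) /\
      (* (iii) *)
      (forall (d : measure_display) (W : measurableType d)
          (Q : probability W R) (A : algorithm R T N W),
        measurable_algorithm A ->
        (forall I, F I -> succeeds b Q A eps (3 / 4) I) ->
        ccov * (T%:R ^+ 3 / (r * eps ^+ 2)) <=
          (\sum_(1 <= t < T.+1) N t)%N%:R).
Proof.
(* 96 comes from the averaging bound, [16^2] from [delta = 16 * eps / K], and [2^3] from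
   [T = 2 * K]. *)
exists (1 / (96 * 16 ^+ 2 * 2 ^+ 3)).
  by rewrite divr_gt0// !mulr_gt0// exprn_gt0.
move=> T K r eps -> {T} K2 /andP[r0 r1] /andP[eps0 epsK].
have K0 : (0 < K)%N by rewrite lt0n; apply: contraTneq K2 => ->.
have k0 : 0 < K%:R :> R by rewrite ltr0n.
pose delta : R := 16 * eps / K%:R.
have delta0 : 0 < delta by rewrite divr_gt0// mulr_gt0.
(* The upper bound is the assumption [eps <= T / 512 = K / 256]. *)
have delta01 : 0 <= delta <= 1 / 16.
  rewrite ltW//= ler_pdivrMr//; move: epsK; rewrite natrM; lra.
exists [set I | exists s : {ffun 'I_K -> bool},
  I = hard_instance (2 * K) delta01 (sign s)].
split; [|split].
(* Both odd-period demands lie below 7/8; an even period has mass 3/4 at 5/8, below the cap, and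
   mass 1/4 at 1, above it. *)
- move=> _ [s ->] t tT; split.
    rewrite [X in (_ < X)%E](two_pointE _ _ _ (low_prob01 delta01 (sign s) t)).
    rewrite /low_prob /low_demand /high_demand !diracE.
    case: (odd t).
      rewrite !mem_set/= ?in_itv/= ?mule1 -?EFinD ?lte_fin; try lra.
    rewrite mem_set/= ?in_itv/=; last by lra.
    rewrite memNset/= ?in_itv/=; last by apply/negP; rewrite -leNgt; lra.
    by rewrite mule1 mule0 adde0 lte_fin; lra.
  move=> /negbTE et.
  rewrite [X in (_ < X)%E](two_pointE _ _ _ (low_prob01 delta01 (sign s) t)).
  rewrite /low_prob /low_demand /high_demand !diracE et.
  rewrite memNset/= ?in_itv/=; last by apply/negP; rewrite andbT -leNgt; lra.
  rewrite mem_set/= ?in_itv/= ?andbT; last by lra.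
  by rewrite mule1 mule0 add0e lte_fin; lra.
- by move=> _ [s ->].
move=> N rN.
pose m t := Num.truncn (r * (N t)%:R).
have mE t : (1 <= t <= 2 * K)%N -> odd t -> r * (N t)%:R = (m t)%:R.
  by move=> tT ot; have [k kE] := rN t tT ot; rewrite /m kE natrK.
have mN t : (1 <= t <= 2 * K)%N -> odd t -> (m t <= N t)%N.
  by move=> tT ot; rewrite -(ler_nat R) -mE// ler_piMl.
(* In an odd period the first [m t] logs get boundary 7/8 and the others 0, below both demands, so
   these always record 0. *)
pose b : boundaries R N :=
  fun t j => if odd t && (m t <= j)%N then 0 else 7 / 8.
have b78 t (j : 'I_(N t)) : odd t -> (b t j == 7 / 8) = (j < m t)%N.
  move=> ot; rewrite /b ot /= leqNgt; case: ltnP => /= _; first by rewrite eqxx.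
  by apply/eqP; lra.
have coveredE t : (1 <= t <= 2 * K)%N -> odd t ->
    (covered b t)%:R = r * (N t)%:R.
  move=> tT ot; rewrite mE// -(card_ord_lt (mN t tT ot)); congr _%:R.
  by apply: eq_card => j; rewrite !inE b78.
have bblind t (j : 'I_(N t)) : b t j <> 7 / 8 -> b t j < 1 / 4.
  by rewrite /b; case: ifP => // _ _; lra.
exists b; split; [|split].
- by move=> t tT j; rewrite /b; case: ifP => // _; lra.
- move=> t tT; case: ifP => ot; first by split; [exact: coveredE|exact: bblind].
  by move=> j; rewrite /b ot.
move=> d W Q A mA succ.
have oT (i : 'I_K) : (1 <= i.*2.+1 <= 2 * K)%N by rewrite /= -mul2n ltn_pmul2l.
have h : K%:R <= 96 * delta ^+ 2 * \sum_(i < K) (covered b i.*2.+1)%:R.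
  apply: (@succeeds_sum_covered_ge _ _ _ delta01 N b _ _ _ Q A mA eps) => //.
  - by move=> i iK j; exact: bblind.
  - by rewrite /delta mulfVK ?gt_eqF.
  - by move=> s; apply: succ; exists s.
pose M : R := (\sum_(1 <= t < (2 * K).+1) N t)%N%:R.
have SM : \sum_(i < K) (covered b i.*2.+1)%:R <= r * M.
  under eq_bigr => i _ do rewrite coveredE ?oT//= ?odd_double//.
  rewrite -mulr_sumr ler_pM2l// /M big_add1/= big_mkord natr_sum.
  exact: (sum_double_le K (f := fun j => (N j.+1)%:R)).
rewrite -/M.
have h' : K%:R <= 96 * delta ^+ 2 * (r * M).
  by apply: (le_trans h); rewrite ler_wpM2l// mulr_ge0// sqr_ge0.
have dK : delta * K%:R = 16 * eps by rewrite /delta mulfVK ?gt_eqF.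
rewrite natrM mulrA ler_pdivrMr ?mulr_gt0 ?exprn_gt0//.
have : K%:R * K%:R ^+ 2 <= 96 * (16 * eps) ^+ 2 * (r * M).
  rewrite -dK.
  rewrite [leRHS](_ : _ = (96 * delta ^+ 2 * (r * M)) * K%:R ^+ 2); last by ring.
  by rewrite ler_wpM2r// sqr_ge0.
lra.
Qed.
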